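(* Every non-feebly compact non-precompact saturated $T_1$ paratopological group $G$ with a dense strictly $\sigma$-discrete subspace has a closed suitable set.
   Context: A paratopological group is a group $G$ endowed with a topology such that the group operation $G\times G\to G$ is continuous (inversion need not be continuous). The identity is denoted by $e$. A subset $S$ of a paratopological group $G$ is a suitable set for $G$ if $S$ is a discrete subspace of $G$, $S\cup\{e\}$ is closed in $G$, and the subgroup $\langle S\rangle$ generated by $S$ is dense in $G$. A closed suitable set is a suitable set that is closed in $G$. A space is feebly compact if each locally finite family of its non-empty open subsets is finite. A paratopological group $G$ is precompact if for each neighborhood $U$ of the identity there exists a finite subset $F$ of $G$ such that $FU=G$. A paratopological group $G$ is saturated if for each neighborhood $U$ of the identity of $G$, the inverse $U^{-1}$ has non-empty interior in $G$. A subset $Y$ of a space $X$ is strictly $\sigma$-discrete (in $X$) if $Y$ is a countable union of closed discrete subsets of $X$. *)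

(* Defs.v *)
From HB Require Import structures.
From mathcomp Require Import all_boot.
From mathcomp Require Import all_classical.
From mathcomp Require Import topology.

Set Implicit Arguments.
Unset Strict Implicit.
Unset Printing Implicit Defensive.

Local Open Scope classical_set_scope.
Local Open Scope group_scope.

HB.structure Definition PreTopologicalGroup := {G of Topological G & Group G}.

HB.mixin Record PreTopologicalGroup_isParatopologicalGroup G
    & PreTopologicalGroup G := {
  mulg_continuous : continuous (fun x : G * G => x.1 * x.2)
}.

#[short(type="paratopologicalGroupType")]
HB.structure Definition ParatopologicalGroup :=
  {G of PreTopologicalGroup G & PreTopologicalGroup_isParatopologicalGroup G}.

Section Spaces.
Context {T : topologicalType}.

Definition discrete_subspace (S : set T) := S `<=` isolated S.

Definition strictly_sigma_discrete (Y : set T) :=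
  exists D : nat -> set T,
    (forall n, closed (D n) /\ discrete_subspace (D n)) /\
    Y = \bigcup_n D n.

(* Families are sets of subsets: for an indexed family of non-empty sets, local
   finiteness already makes every member occur only finitely often, so indexing
   would not change [feebly_compact]. *)
Definition locally_finite (F : set (set T)) :=
  forall x : T, exists2 V : set T, nbhs x V &
    finite_set [set U | F U /\ U `&` V !=set0].

End Spaces.

Definition feebly_compact (T : topologicalType) :=
  forall F : set (set T),
    (forall U, F U -> open U /\ U !=set0) -> locally_finite F -> finite_set F.

Definition generated_subgroup (G : groupType) (S : set G) : set G :=
  smallest (fun H : set G => group_closed [in H]) S.

Section ParatopologicalGroups.
Variable G : paratopologicalGroupType.

(* Not the library's [precompact], which means relatively compact. *)
Definition precompact_group :=
  forall U : set G, nbhs 1 U ->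
    exists2 F : set G, finite_set F &
      [set x * y | x in F & y in U] = [set: G].

Definition saturated :=
  forall U : set G, nbhs 1 U -> interior [set x^-1 | x in U] !=set0.

Definition suitable_set (S : set G) :=
  [/\ discrete_subspace S, closed (S `|` [set 1]) &
      dense (generated_subgroup S)].

Definition closed_suitable_set (S : set G) := suitable_set S /\ closed S.

End ParatopologicalGroups.

(* Main.v *)
Require Import Defs.
From mathcomp Require Import all_boot.
From mathcomp Require Import all_classical.
From mathcomp Require Import topology.

(** Since G is saturated, the sets U U^-1, for U a neighbourhood of 1, are the
    basic neighbourhoods of 1 in a group topology coarser than that of G (its
    group reflection), and every non-empty open set of G contains a translate
    of such a set.  Hence non-precompactness of G passes to the reflection
    and gives an open W containing 1 and points x_n such that every point of G has a
    neighbourhood meeting at most one x_n W.  If the dense set is the union of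
    the closed discrete sets D_n, then the points x_n and x_n d with d in D_n
    and in W form a closed discrete set, and so does this set together with a
    transversal of the left cosets of the open subgroup generated by W.  The
    subgroup it generates is dense in W, so its closure in the reflection is a
    subgroup containing W and the transversal, i.e. all of G; by saturation it
    is then dense in G. *)

Set Implicit Arguments.
Unset Strict Implicit.
Unset Printing Implicit Defensive.

Local Open Scope classical_set_scope.
Local Open Scope group_scope.

Ltac group_normalize :=
  rewrite ?(invgM, invgK, invg1, mulgA, mulgK, mulgVK, mulgV, mulVg,
            mul1g, mulg1).

Definition quotients (G : groupType) (U : set G) : set G :=
  [set x / y | x in U & y in U].

(** * Closed discrete sets as a local condition *)

Section ClosedDiscrete.
Context {T : topologicalType}.
Implicit Types (S : set T).

Definition closed_discrete S :=
  forall y : T, exists2 V : set T, nbhs y V & V `&` S `<=` [set y].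

Lemma closed_discreteP S :
  closed_discrete S <-> closed S /\ discrete_subspace S.
Proof.
split=> [cdS|[clS dS] y].
  split=> [y /= ySc|y Sy].
    have [V yV VS] := cdS y; have [z [Sz Vz]] := ySc _ yV.
    by rewrite -(VS z).
  have [V yV VS] := cdS y; split; first exact/mem_set.
  exists V => //; apply/seteqP; split=> // z ->.
  by split=> //; exact: nbhs_singleton.
have [Sy|Sy] := pselect (S y).
  by have [_ [V yV VS]] := dS _ Sy; exists V => //; rewrite VS.
exists (~` S); last by rewrite setICl.
by apply: open_nbhs_nbhs; split=> //; exact: closed_openC.
Qed.

Lemma closed_discreteU S S' :
  closed_discrete S -> closed_discrete S' -> closed_discrete (S `|` S').
Proof.
move=> cd cd' y; have [V yV VS] := cd y; have [V' yV' VS'] := cd' y.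
exists (V `&` V'); first exact: filterI.
by move=> z [[Vz V'z] [Sz|S'z]]; [exact: VS | exact: VS'].
Qed.

Lemma closed_discrete1 (x : T) : accessible_space T -> closed_discrete [set x].
Proof.
move=> T1; apply/closed_discreteP; split; first exact: accessible_closed_set1.
move=> _ ->; split; first exact/mem_set.
by exists setT; [exact: filterT | rewrite setTI].
Qed.

Lemma closed_discrete_local S :
  (forall y : T, exists V S' : set T,
    [/\ nbhs y V, closed_discrete S' & V `&` S `<=` S'])
  -> closed_discrete S.
Proof.
move=> loc y; have [V [S' [yV cd VS]]] := loc y.
have [V' yV' V'S] := cd y; exists (V `&` V'); first exact: filterI.
by move=> z [[Vz V'z] Sz]; apply: V'S; split=> //; exact: VS.
Qed.

End ClosedDiscrete.

Section GeneratedSubgroup.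
Context {G : groupType}.
Implicit Types S H : set G.

Lemma group_closedP H :
  group_closed [in H] <->
  [/\ H 1, forall x, H x -> H x^-1 & forall x y, H x -> H y -> H (x * y)].
Proof.
split=> [cl|[H1 HV HM]].
  have HV := group_closedV cl; have HM := group_closedM cl.
  split=> [|x|x y].
  - by have [/set_mem] := cl.
  - by move=> /mem_set /HV /set_mem.
  - by move=> /mem_set xH /mem_set yH; have /set_mem := HM _ _ xH yH.
split; first exact/mem_set.
by move=> x y /set_mem Hx /set_mem Hy; apply/mem_set/HM/HV.
Qed.

Lemma generated_subgroup_closed S : group_closed [in generated_subgroup S].
Proof.
apply/group_closedP; split.
- by move=> H [/group_closedP[]].
- by move=> x Sx H SH; have [/group_closedP[_ + _] _] := SH; apply; exact: Sx.
- move=> x y Sx Sy H SH; have [/group_closedP[_ _ +] _] := SH.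
  by apply; [exact: Sx | exact: Sy].
Qed.

Lemma generated_subgroup_min S H :
  group_closed [in H] -> S `<=` H -> generated_subgroup S `<=` H.
Proof. by move=> cH SH x Sx; apply: Sx. Qed.

End GeneratedSubgroup.

(** * Translations and conjugations near the identity *)

Section Translations.
Context {G : paratopologicalGroupType}.
Implicit Types (g x y : G) (U V : set G).

Lemma nbhs_mulg x y U : nbhs (x * y) U ->
  exists V W, [/\ nbhs x V, nbhs y W & forall v w, V v -> W w -> U (v * w)].
Proof.
move=> /(@mulg_continuous G (x, y))[[V W] [xV yW] VWU].
by exists V, W; split=> // v w Vv Ww; exact: (VWU (v, w)).
Qed.

Lemma nbhs_mulgl g x U : nbhs (g * x) U -> nbhs x [set y | U (g * y)].
Proof.
move=> /nbhs_mulg[V [W [/nbhs_singleton gV xW VWU]]].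
by apply: filterS xW => y Wy; exact: VWU.
Qed.

Lemma nbhs_mulgr g x U : nbhs (x * g) U -> nbhs x [set y | U (y * g)].
Proof.
move=> /nbhs_mulg[V [W [xV /nbhs_singleton gW VWU]]].
by apply: filterS xV => y Vy; exact: VWU.
Qed.

Lemma nbhs1_mulg U : nbhs 1 U ->
  exists2 V, nbhs 1 V & forall v w, V v -> V w -> U (v * w).
Proof.
rewrite -{1}(mulg1 1) => /nbhs_mulg[V [W [V1 W1 VWU]]].
exists (V `&` W); first exact: filterI.
by move=> v w [Vv _] [_ Ww]; exact: VWU.
Qed.

Lemma nbhs1_conj g U : nbhs 1 U -> nbhs 1 [set y | U (g * y / g)].
Proof.
move=> U1; apply: (@nbhs_mulgl g _ [set y | U (y / g)]).
by apply: nbhs_mulgr; rewrite mulg1 mulgV.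
Qed.

Lemma closed_discrete_translate g (S : set G) :
  closed_discrete S -> closed_discrete [set g * x | x in S].
Proof.
move=> cd y; have [V yV VS] := cd (g^-1 * y).
exists [set z | V (g^-1 * z)]; first exact: nbhs_mulgl.
move=> z [Vz [x Sx xz]]; move: Vz; rewrite -xz /= mulKg => Vx.
by rewrite (VS x) // mulVKg.
Qed.

End Translations.

(** * Saturation and the group reflection *)

Section Saturated.
Context {G : paratopologicalGroupType} (satG : saturated G).
Implicit Types (U V : set G).

(** Take [h] interior to [U'^-1]. For [a], [b] near 1, [h^-1 a h] lies in [U'] and [b h] in [U'^-1],
    so [h^-1 (a / b) = (h^-1 a h) (b h)^-1] lies in [U' U']. *)
Lemma saturated_quotients U : nbhs 1 U ->
  exists V g, nbhs 1 V /\ forall c, quotients V c -> U (g * c).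
Proof.
move=> /nbhs1_mulg[U' U'1 U'U].
have [h hU'] := satG U'1.
exists [set c | U' (h^-1 * c * h) /\ [set x^-1 | x in U'] (c * h)], h^-1.
split.
  apply: filterI.
    by have := nbhs1_conj h^-1 U'1; apply: filterS => c; rewrite /= invgK.
  by apply: (@nbhs_mulgr _ h 1 [set x^-1 | x in U']); rewrite mul1g.
move=> _ [a [U'a _] [b [_ [b' U'b' bh]] <-]].
have -> : h^-1 * (a / b) = h^-1 * a * h * (b * h)^-1 by group_normalize.
by rewrite -bh invgK; exact: U'U.
Qed.

(** With [h] interior to [W^-1], points [b], [c] near 1 have the form [h^-1 b'^-1], [h^-1 c'^-1]
    with [b'], [c'] in [W]. Hence [h] cancels in [b^-1 c = b' c'^-1]. *)
Lemma saturated_quotients_mul U : nbhs 1 U -> exists2 V, nbhs 1 V &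
  forall c d, quotients V c -> quotients V d -> quotients U (c * d).
Proof.
move=> /nbhs1_mulg[W W1 WU].
have [h hW] := satG W1.
pose M := [set m | [set x^-1 | x in W] (h * m)].
have M1 : nbhs 1 M.
  by apply: (@nbhs_mulgl _ h 1 [set x^-1 | x in W]); rewrite mulg1.
exists (W `&` M); first exact: filterI.
move=> _ _ [a [Wa _] [b [_ [b' Wb' hb]] <-]] [c [_ [c' Wc' hc]] [d [Wd _] <-]].
exists (a * b'); first exact: WU.
exists (d * c'); first exact: WU.
have -> : b' = b^-1 * h^-1 by rewrite -invgM -hb invgK.
have -> : c' = c^-1 * h^-1 by rewrite -invgM -hc invgK.
by group_normalize.
Qed.

(** A greedy choice outside finitely many translates. The last clause says that [y W] meets at most
    one of the sets [x i W]. *)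
Lemma uniformly_discrete_sequence : ~ precompact_group G ->
  exists (x : nat -> G) (W : set G), [/\ open W, W 1 &
    forall y i j u v s t, W u -> W v -> W s -> W t ->
      y * u = x i * s -> y * v = x j * t -> i = j].
Proof.
move=> npc.
have [U [U1 UF]] : exists U : set G, nbhs 1 U /\
    forall F, finite_set F -> exists z, ~ [set x * y | x in F & y in U] z.
  apply: contrapT => nU; apply: npc => U U1; apply: contrapT => nF.
  apply: nU; exists U; split=> // F finF; apply: contrapT => nz.
  apply: nF; exists F => //; apply/seteqP; split=> // z _.
  by apply: contrapT => Fz; apply: nz; exists z.
have [P [g [P1 PU]]] := saturated_quotients U1.
have step (s : seq G) : exists z, forall x, x \in s -> ~ quotients P (x^-1 * z).
  (* [U] contains [g * quotients P], so a point outside every [(x / g) U] avoids every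
     [x * quotients P]. *)
  have [z nz] := UF [set x / g | x in [set` s]]
                    (finite_image _ (finite_seq s)).
  exists z => x xs Pz; apply: nz.
  exists (x / g); first by exists x.
  by exists (g * (x^-1 * z)); [exact: PU | group_normalize].
have [c cP] := choice step.
(* [s n] lists the first [n] chosen points; the next one is [c (s n)]. *)
pose s := fix s n := if n is n'.+1 then c (s n') :: s n' else [::].
have s_mem i n : i < n -> c (s i) \in s n.
  elim: n => // n IHn; rewrite ltnS leq_eqVlt inE => /predU1P[->|/IHn ->].
    by rewrite eqxx.
  by rewrite orbT.
have [V V1 VP] := saturated_quotients_mul P1.
exists (c \o s), V°; split; first exact: open_interior.
  exact: nbhs_singleton (nbhs_interior V1).
have sep y i j u v p q : V u -> V v -> V p -> V q ->
    y * u = c (s i) * p -> y * v = c (s j) * q -> ~ (i < j).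
  move=> Vu Vv Vp Vq yu yv ij; apply: (cP _ _ (s_mem _ _ ij)).
  have -> : c (s i) = y * u / p by rewrite yu; group_normalize.
  have -> : c (s j) = y * v / q by rewrite yv; group_normalize.
  have -> : (y * u / p)^-1 * (y * v / q) = (p / u) * (v / q).
    by group_normalize.
  by apply: VP; [exists p => //; exists u | exists v => //; exists q].
move=> y i j u v p q /interior_subset Vu /interior_subset Vv
  /interior_subset Vp /interior_subset Vq yu yv.
case: (ltngtP i j) => // ij; exfalso.
- exact: sep Vu Vv Vp Vq yu yv ij.
- exact: sep Vv Vu Vq Vp yv yu ij.
Qed.

(* The closure of H in the group reflection of G. *)
Definition reflection_closure (H : set G) : set G :=
  [set x | forall U, nbhs 1 U -> exists2 h, H h & quotients U (x^-1 * h)].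

Lemma sub_reflection_closure H : H `<=` reflection_closure H.
Proof.
move=> h Hh U /nbhs_singleton U1; exists h => //.
by exists 1 => //; exists 1 => //; group_normalize.
Qed.

(** Neighbourhoods of 1 can be conjugated; add the symmetry of [quotients U] for inverses and
    [saturated_quotients_mul] for products. *)
Lemma reflection_closure_closed H :
  group_closed [in H] -> group_closed [in reflection_closure H].
Proof.
move=> /group_closedP[H1 HV HM]; apply/group_closedP; split.
- exact: sub_reflection_closure.
- move=> x Hx U U1.
  have [h Hh [a Ua [b Ub ab]]] := Hx _ (nbhs1_conj x U1).
  exists h^-1; first exact: HV.
  exists (x * b / x) => //; exists (x * a / x) => //.
  have -> : h = x * (a / b) by rewrite ab mulVKg.
  by group_normalize.
- move=> x y Hx Hy U /saturated_quotients_mul[V V1 VU].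
  have [k Hk Vk] := Hy _ V1.
  have [h Hh [a Va [b Vb ab]]] := Hx _ (nbhs1_conj y^-1 V1).
  exists (h * k); first exact: HM.
  have -> : (x * y)^-1 * (h * k) = (y^-1 * (x^-1 * h) * y) * (y^-1 * k).
    by group_normalize.
  apply: VU => //; exists (y^-1 * a / y^-1) => //.
  exists (y^-1 * b / y^-1) => //.
  by rewrite -ab; group_normalize.
Qed.

(** An open set around [y] contains some [y g (P P^-1)], a neighbourhood of [y g] in the reflection,
    and so meets [H]. *)
Lemma reflection_closure_dense H :
  reflection_closure H = setT -> dense H.
Proof.
move=> HT O [y Oy] oO.
have [P [g [P1 PO]]] : exists V g, nbhs 1 V /\
    forall c, quotients V c -> [set z | O (y * z)] (g * c).
  apply/saturated_quotients/nbhs_mulgl; rewrite mulg1.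
  exact: open_nbhs_nbhs.
have : reflection_closure H (y * g) by rewrite HT.
move=> /(_ _ P1)[h Hh /PO /= Oh]; exists h; split=> //.
by move: Oh; rewrite mulgA mulVKg.
Qed.

End Saturated.

(** The cosets of [generated_subgroup W] are open, and each contains only one chosen
    representative. *)
Lemma closed_discrete_transversal (G : paratopologicalGroupType) (W : set G) :
  accessible_space G -> nbhs 1 W ->
  exists2 A : set G, closed_discrete A &
    forall x, exists2 a, A a & generated_subgroup W (a^-1 * x).
Proof.
move=> T1 W1; pose N := generated_subgroup W.
have /group_closedP[N1 NV NM] : group_closed [in N].
  exact: generated_subgroup_closed.
pose coset x : set G := [set y | N (x^-1 * y)].
(* [coset x] contains [x], so [xget] never falls back on 1. *)
pose r x := xget 1 (coset x).
have rP x : coset x (r x) by apply: (xgetI _ (x := x)); rewrite /coset /= mulVg.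
have rE x y : coset x y -> r x = r y.
  rewrite /coset /= => xy; congr (xget _ _).
  apply/seteqP; split=> z; rewrite /coset /= => Nz.
    have -> : y^-1 * z = (x^-1 * y)^-1 * (x^-1 * z) by group_normalize.
    by apply: NM => //; exact: NV.
  have -> : x^-1 * z = (x^-1 * y) * (y^-1 * z) by group_normalize.
  exact: NM.
exists (range r).
  apply: closed_discrete_local => y.
  exists (coset y), [set r y]; split; last first.
  - by move=> z [yz [x _ xz]]; rewrite /= -xz (rE x (r x)) // xz (rE y z).
  - exact: closed_discrete1.
  - apply: (@nbhs_mulgl _ y^-1 y N); rewrite mulVg.
    by apply: filterS W1; exact: sub_gen_smallest.
move=> x; exists (r x); first by exists x.
have -> : (r x)^-1 * x = (x^-1 * r x)^-1 by group_normalize.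
exact: NV _ (rP x).
Qed.

Theorem proposition4p11 (G : paratopologicalGroupType)
  (G_not_feebly_compact : ~ feebly_compact G)
  (G_not_precompact : ~ precompact_group G)
  (G_saturated : saturated G)
  (G_T1 : accessible_space G)
  (G_dense_sigma_discrete :
    exists Y : set G, dense Y /\ strictly_sigma_discrete Y) :
  exists S : set G, closed_suitable_set S.
Proof.
have [x [W [oW W1 xW]]] :=
  uniformly_discrete_sequence G_saturated G_not_precompact.
have nW : nbhs 1 W by exact: open_nbhs_nbhs.
have [A cdA AW] := closed_discrete_transversal G_T1 nW.
have [Y [dY [D [cdD YE]]]] := G_dense_sigma_discrete.
(* Adding 1 puts [x n] itself into [X], so that it can be cancelled from [x n * d]. *)
pose E n : set G := D n `|` [set 1].
have cdE n : closed_discrete (E n).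
  apply: closed_discreteU; first exact/closed_discreteP.
  exact: closed_discrete1.
pose X := [set z | exists n d, [/\ E n d, W d & z = x n * d]].
have cdX : closed_discrete X.
  apply: closed_discrete_local => y; pose V := [set z | W (y^-1 * z)].
  (* [V] is [y W], which meets [x n W] for at most one [n]. *)
  have [n nV] : exists n, V `&` X `<=` [set x n * d | d in E n].
    have [[z [yz [n [d [End Wd zE]]]]]|no] := pselect (V `&` X !=set0).
      rewrite zE in yz; exists n => z' [yz' [m [d' [Emd Wd' z'E]]]]; move: yz'.
      rewrite z'E => yz'.
      suff -> : n = m by exists d'.
      by apply: (xW y _ _ _ _ _ _ yz yz' Wd Wd'); rewrite mulVKg.
    (* If [V] misses [X], any index will do. *)
    by exists 0 => z Vz; case: no; exists z.
  exists V, [set x n * d | d in E n]; split=> //.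
    by apply: (@nbhs_mulgl _ y^-1 y W); rewrite mulVg.
  exact: closed_discrete_translate.
have /closed_discreteP[clS dS] := closed_discreteU cdX cdA.
exists (X `|` A); split=> //; split=> //.
  by apply: closedU => //; exact: accessible_closed_set1.
set H := generated_subgroup _.
have cH : group_closed [in H] by exact: generated_subgroup_closed.
have /group_closedP[_ HV HM] := cH.
have XH z : X z -> H z by move=> Xz; apply: sub_gen_smallest; left.
have WK : W `<=` reflection_closure H.
  move=> w Ww U U1.
  pose O := W `&` interior [set z | U (w^-1 * z)].
  have [|z [[Wz Uz]]] := dY O _ (openI oW (open_interior _)).
    exists w; split=> //; apply: nbhs_singleton; apply: nbhs_interior.
    by apply: nbhs_mulgl; rewrite mulVg.
  rewrite YE => -[n _ Dnz]; exists z; last first.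
    (* The denominator 1 turns closeness in [G] into closeness in the reflection. *)
    exists (w^-1 * z); first exact: (interior_subset Uz).
    by exists 1; [exact: nbhs_singleton | group_normalize].
  rewrite -(mulKg (x n) z); apply: HM.
    by apply: HV; apply: XH; exists n, 1; split=> //; [right | rewrite mulg1].
  by apply: XH; exists n, z; split=> //; left.
have cK := reflection_closure_closed G_saturated cH.
apply: reflection_closure_dense => //; apply/seteqP; split=> // g _.
(* Write [g] as [a] times [a^-1 g], the latter in the subgroup generated by [W]. *)
have [a Aa aW] := AW g; rewrite -(mulVKg a g).
have /group_closedP[_ _ KM] := cK; apply: KM.
  by apply: sub_reflection_closure; apply: sub_gen_smallest; right.
exact: (generated_subgroup_min cK WK).
Qed.
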